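(* Let $0<q<1$ and let $\sigma:\Sigma^4_q\to B(\ell^2(\mathbb N)^{\otimes2})$ be the representation described in the context. Then $\sigma(x)\in B(\ell^2(\mathbb N)^{\otimes2})$ is a trace class operator for each $x\in\overline{\Sigma^4_q}$, where $\overline{\Sigma^4_q}=\ker\epsilon\cong\Sigma^4_q/\mathbb C1$ is the kernel of the one-dimensional representation $\epsilon$.
   Context: $\mathbb S^7_q$ is the unital complex $*$-algebra generated by $z_1,\dots,z_4$ with relations $z_iz_j=qz_jz_i$ ($i<j$), $z_j^*z_i=qz_iz_j^*$ ($i\ne j$), $z_k^*z_k=z_kz_k^*+(1-q^2)\sum_{j<k}z_jz_j^*$, $\sum_{k=1}^4z_kz_k^*=1$. The quantum 4-sphere $\Sigma^4_q$ is the unital $*$-subalgebra of $\mathbb S^7_q$ generated by $a=z_1z_4^*-z_2z_3^*$, $b=z_1z_3+q^{-1}z_2z_4$, $R=z_1z_1^*+z_2z_2^*$ (equivalently, the algebra of coinvariants of $\mathbb S^7_q$ under the quantum coisotropic subgroup $SU_q(2)$ of $U_q(4)$). The generators satisfy $Ra=q^{-2}aR$, $Rb=q^2bR$, $ab=q^3ba$, $ab^*=q^{-1}b^*a$, $aa^*+q^2bb^*=R(1-q^2R)$, $aa^*=q^2a^*a+(1-q^2)R^2$, $b^*b=q^4bb^*+(1-q^2)R$. $\Sigma^4_q$ has a one-dimensional unital $*$-representation $\epsilon:\Sigma_q^4\to\mathbb C$ with $\epsilon(R)=\epsilon(a)=\epsilon(b)=0$, and a unital $*$-representation $\sigma:\Sigma^4_q\to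 B(\ell^2(\mathbb N)^{\otimes2})$ given on the orthonormal basis $|n_1,n_2\rangle$, $n_1,n_2\ge0$, by $$\sigma(R)|n_1,n_2\rangle=q^{2(n_1+n_2)}|n_1,n_2\rangle,$$ $$\sigma(a)|n_1,n_2\rangle=q^{n_1+2n_2-1}(1-q^{2n_1})^{1/2}|n_1-1,n_2\rangle,$$ $$\sigma(b)|n_1,n_2\rangle=q^{n_1+n_2}(1-q^{2(n_2+1)})^{1/2}|n_1,n_2+1\rangle .$$ *)

(* Defs.v *)
From HB Require Import structures.
From mathcomp Require Import all_boot all_order all_algebra.
From mathcomp Require Import complex.
From mathcomp Require Import ring lra.
From mathcomp Require Import all_classical all_reals all_analysis.

Set Implicit Arguments.
Unset Strict Implicit.
Unset Printing Implicit Defensive.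
Import Order.TTheory GRing.Theory Num.Theory.
Local Open Scope classical_set_scope.
Local Open Scope ring_scope.
Local Open Scope complex_scope.
Local Open Scope quotient_scope.

(* The complex numbers are R[i]; all algebras are unital. *)

HB.mixin Record isStarAlgebra (R : realType) A of GRing.Algebra R[i] A := {
  star : A -> A;
  starK : involutive star;
  starD : forall x y, star (x + y) = star x + star y;
  starM : forall x y, star (x * y) = star y * star x;
  starZ : forall c x, star (c *: x) = c^* *: star x }.

#[short(type="starAlgType")]
HB.structure Definition StarAlgebra (R : realType) :=
  {A of isStarAlgebra R A & GRing.Algebra R[i] A}.

Definition star_subalg_closed (R : realType) (A : starAlgType R) (S : set A) :=
  [/\ S 1,
      forall x y, S x -> S y -> S (x + y),
      forall x y, S x -> S y -> S (x * y),
      forall c x, S x -> S (c *: x) &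
      forall x, S x -> S (star x)].

Definition star_subalg (R : realType) (A : starAlgType R) (G : set A) : set A :=
  smallest (@star_subalg_closed R A) G.

Lemma star_subalg_subproof (R : realType) (A : starAlgType R) (G : set A) :
  star_subalg_closed (star_subalg G).
Proof.
split.
- by move=> S [[]].
- by move=> x y Sx Sy S SG; case: (SG) => -[_ + _ _ _] _; apply; [exact: Sx | exact: Sy].
- by move=> x y Sx Sy S SG; case: (SG) => -[_ _ + _ _] _; apply; [exact: Sx | exact: Sy].
- by move=> c x Sx S SG; case: (SG) => -[_ _ _ + _] _; apply; exact: Sx.
- by move=> x Sx S SG; case: (SG) => -[_ _ _ _ +] _; apply; exact: Sx.
Qed.

Inductive star_term (G C : Type) : Type :=
| Gen of G
| Cst of C
| Add of star_term G C & star_term G C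
| Mul of star_term G C & star_term G C
| Star of star_term G C.
Arguments Gen {G C}.
Arguments Cst {G C}.

HB.instance Definition _ (G C : Type) := gen_eqMixin (star_term G C).
HB.instance Definition _ (G C : Type) := gen_choiceMixin (star_term G C).

(* The least congruence containing the relations [E] and making the terms a
   unital star-algebra over R[i], where [Cst c] stands for c times the unit. *)
Inductive star_cong (R : realType) (G : Type)
    (E : star_term G R[i] -> star_term G R[i] -> Prop) :
    star_term G R[i] -> star_term G R[i] -> Prop :=
| cong_rel s t : E s t -> star_cong E s t
| cong_refl s : star_cong E s s
| cong_sym s t : star_cong E s t -> star_cong E t s
| cong_trans s t u : star_cong E s t -> star_cong E t u -> star_cong E s u
| cong_add s s' t t' : star_cong E s s' -> star_cong E t t' ->
    star_cong E (Add s t) (Add s' t')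
| cong_mul s s' t t' : star_cong E s s' -> star_cong E t t' ->
    star_cong E (Mul s t) (Mul s' t')
| cong_star s s' : star_cong E s s' -> star_cong E (Star s) (Star s')
| cong_addA s t u : star_cong E (Add s (Add t u)) (Add (Add s t) u)
| cong_addC s t : star_cong E (Add s t) (Add t s)
| cong_add0 s : star_cong E (Add (Cst 0) s) s
| cong_mulA s t u : star_cong E (Mul s (Mul t u)) (Mul (Mul s t) u)
| cong_mul1 s : star_cong E (Mul (Cst 1) s) s
| cong_mul0 s : star_cong E (Mul (Cst 0) s) (Cst 0)
| cong_mulDl s t u : star_cong E (Mul (Add s t) u) (Add (Mul s u) (Mul t u))
| cong_mulDr s t u : star_cong E (Mul s (Add t u)) (Add (Mul s t) (Mul s u))
| cong_cstD c d : star_cong E (Add (Cst c) (Cst d)) (Cst (c + d))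
| cong_cstM c d : star_cong E (Mul (Cst c) (Cst d)) (Cst (c * d))
| cong_cstC c s : star_cong E (Mul (Cst c) s) (Mul s (Cst c))
| cong_starK s : star_cong E (Star (Star s)) s
| cong_starD s t : star_cong E (Star (Add s t)) (Add (Star s) (Star t))
| cong_starM s t : star_cong E (Star (Mul s t)) (Mul (Star t) (Star s))
| cong_starC c : star_cong E (Star (Cst c)) (Cst c^*).

(* The indices 1, ..., 4 are shifted to 0, ..., 3. *)
Inductive sphere7_rel (R : realType) (q : R) :
    star_term 'I_4 R[i] -> star_term 'I_4 R[i] -> Prop :=
| sphere7_comm (i j : 'I_4) : (i < j)%N ->
    sphere7_rel q (Mul (Gen i) (Gen j))
                  (Mul (Cst q%:C) (Mul (Gen j) (Gen i)))
| sphere7_scomm (i j : 'I_4) : i != j ->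
    sphere7_rel q (Mul (Star (Gen j)) (Gen i))
                  (Mul (Cst q%:C) (Mul (Gen i) (Star (Gen j))))
| sphere7_norm (k : 'I_4) :
    sphere7_rel q (Mul (Star (Gen k)) (Gen k))
                  (Add (Mul (Gen k) (Star (Gen k)))
                       (Mul (Cst (1 - q ^+ 2)%:C)
                          (\big[@Add _ _/Cst 0]_(j < 4 | (j < k)%N)
                             Mul (Gen j) (Star (Gen j)))))
| sphere7_sum :
    sphere7_rel q (\big[@Add _ _/Cst 0]_(k < 4) Mul (Gen k) (Star (Gen k)))
                  (Cst 1).

Section Sphere7.
Variables (R : realType) (q : R).
Local Notation term := (star_term 'I_4 R[i]).
Local Notation cong := (star_cong (sphere7_rel q)).

Let congb (s t : term) : bool := `[< cong s t >].

Lemma sphere7_equiv : equiv_class_of congb.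
Proof.
split.
- by move=> s; apply/asboolP; exact: cong_refl.
- by move=> s t; apply/asboolP/asboolP; exact: cong_sym.
- by move=> t s u /asboolP st /asboolP tu; apply/asboolP; exact: cong_trans st tu.
Qed.

Definition sphere7_equiv_rel : equiv_rel term := EquivRelPack sphere7_equiv.

Definition Sphere7 : Type := {eq_quot sphere7_equiv_rel}.
HB.instance Definition _ := Choice.on Sphere7.

Definition cls (t : term) : Sphere7 := \pi_{eq_quot sphere7_equiv_rel} t.
Let rp (x : Sphere7) : term := repr (x : {eq_quot sphere7_equiv_rel}).

Lemma clsP s t : cls s = cls t <-> cong s t.
Proof.
split=> [/eqmodP/asboolP // | st].
by apply/eqmodP; apply/asboolP.
Qed.

Let rpK x : cls (rp x) = x. Proof. exact: reprK. Qed.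
Let rp_cls t : cong (rp (cls t)) t. Proof. by apply/clsP; rewrite rpK. Qed.

Definition s7_add x y := cls (Add (rp x) (rp y)).
Definition s7_mul x y := cls (Mul (rp x) (rp y)).
Definition s7_star x := cls (Star (rp x)).
Definition s7_scale (c : R[i]) x := cls (Mul (Cst c) (rp x)).
Definition s7_opp x := s7_scale (-1) x.
Definition s7_zero := cls (Cst 0).
Definition s7_one := cls (Cst 1).

Lemma cls_add s t : s7_add (cls s) (cls t) = cls (Add s t).
Proof. by apply/clsP; apply: cong_add; exact: rp_cls. Qed.
Lemma cls_mul s t : s7_mul (cls s) (cls t) = cls (Mul s t).
Proof. by apply/clsP; apply: cong_mul; exact: rp_cls. Qed.
Lemma cls_star s : s7_star (cls s) = cls (Star s).
Proof. by apply/clsP; apply: cong_star; exact: rp_cls. Qed.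
Lemma cls_scale c s : s7_scale c (cls s) = cls (Mul (Cst c) s).
Proof. by apply/clsP; apply: cong_mul; [exact: cong_refl | exact: rp_cls]. Qed.
Let clsE := (cls_add, cls_mul, cls_star, cls_scale).

Let clsW (P : Sphere7 -> Prop) : (forall t, P (cls t)) -> forall x, P x.
Proof. by move=> Pc x; rewrite -(rpK x). Qed.

Fact s7_addA : associative s7_add.
Proof.
elim/clsW=> s; elim/clsW=> t; elim/clsW=> u.
by rewrite !clsE; apply/clsP; exact: cong_addA.
Qed.

Fact s7_addC : commutative s7_add.
Proof.
by elim/clsW=> s; elim/clsW=> t; rewrite !clsE; apply/clsP; exact: cong_addC.
Qed.

Fact s7_add0 : left_id s7_zero s7_add.
Proof. by elim/clsW=> s; rewrite !clsE; apply/clsP; exact: cong_add0. Qed.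

Fact s7_scaleDl x c d :
  s7_scale (c + d) x = s7_add (s7_scale c x) (s7_scale d x).
Proof.
elim/clsW: x => s; rewrite !clsE; apply/clsP; apply: cong_sym.
apply: cong_trans (cong_sym (cong_mulDl _ _ _ _)) _.
by apply: cong_mul; [exact: cong_cstD | exact: cong_refl].
Qed.

Fact s7_scale1 : left_id 1 s7_scale.
Proof. by elim/clsW=> s; rewrite !clsE; apply/clsP; exact: cong_mul1. Qed.

Fact s7_addN : left_inverse s7_zero s7_opp s7_add.
Proof.
move=> x; rewrite -{2}(s7_scale1 x) -s7_scaleDl addNr.
by elim/clsW: x => s; rewrite clsE; apply/clsP; exact: cong_mul0.
Qed.

HB.instance Definition _ :=
  GRing.isZmodule.Build Sphere7 s7_addA s7_addC s7_add0 s7_addN.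

Fact s7_mulA : associative s7_mul.
Proof.
elim/clsW=> s; elim/clsW=> t; elim/clsW=> u.
by rewrite !clsE; apply/clsP; exact: cong_mulA.
Qed.

Fact s7_mul1x : left_id s7_one s7_mul.
Proof. by elim/clsW=> s; rewrite !clsE; apply/clsP; exact: cong_mul1. Qed.

Fact s7_mulx1 : right_id s7_one s7_mul.
Proof.
elim/clsW=> s; rewrite !clsE; apply/clsP.
exact: cong_trans (cong_sym (cong_cstC _ _ _)) (cong_mul1 _ _).
Qed.

Fact s7_mulDl : left_distributive s7_mul s7_add.
Proof.
elim/clsW=> s; elim/clsW=> t; elim/clsW=> u.
by rewrite !clsE; apply/clsP; exact: cong_mulDl.
Qed.

Fact s7_mulDr : right_distributive s7_mul s7_add.
Proof.
elim/clsW=> s; elim/clsW=> t; elim/clsW=> u.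
by rewrite !clsE; apply/clsP; exact: cong_mulDr.
Qed.

(* The character sending the last generator to 1 and the others to 0; it shows
   that the relations do not collapse the algebra. *)
Let Fixpoint ev (t : term) : R[i] :=
  match t with
  | Gen i => (i == ord_max)%:R
  | Cst c => c
  | Add s t => ev s + ev t
  | Mul s t => ev s * ev t
  | Star s => (ev s)^*
  end.

Fact ev_cong s t : cong s t -> ev s = ev t.
Proof.
have evb (P : pred 'I_4) (F : 'I_4 -> term) :
    ev (\big[@Add _ _/Cst 0]_(j < 4 | P j) F j) = \sum_(j < 4 | P j) ev (F j).
  by elim/big_rec2: _ => //= i y x _ ->.
elim=> {s t} //=.
- move=> s t []/=.
  + move=> i j ij; have -> : (i == ord_max) = false.
      apply/negbTE/eqP => iE; move: ij; rewrite iE /=.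
      by case: j => -[|[|[|[|]]]].
    by rewrite mul0r mulr0 mulr0.
  + move=> i j ij; case: (eqVneq i ord_max) => [iE|_]; last by rewrite mulr0 mul0r mulr0.
    by rewrite -iE eq_sym (negbTE ij) conjc0 mul0r !mulr0.
  + move=> k; rewrite evb big1 ?mulr0 ?addr0 1?mulrC// => j jk /=.
    have -> : (j == ord_max) = false.
      apply/negbTE/eqP => jE; move: jk; rewrite jE /=.
      by case: k => -[|[|[|[|]]]].
    by rewrite mul0r.
  + rewrite evb (bigD1 ord_max) //= big1 ?addr0 ?eqxx ?mul1r /= ?oppr0//.
    by move=> j /negbTE ->; rewrite mul0r.
- by move=> s t u _ -> _ ->.
- by move=> s s' t t' _ -> _ ->.
- by move=> s s' t t' _ -> _ ->.
- by move=> s s' _ ->.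
- by move=> *; rewrite addrA.
- by move=> *; rewrite addrC.
- by move=> *; rewrite add0r.
- by move=> *; rewrite mulrA.
- by move=> *; rewrite mul1r.
- by move=> *; rewrite mul0r.
- by move=> *; rewrite mulrDl.
- by move=> *; rewrite mulrDr.
- by move=> *; rewrite mulrC.
- by move=> *; rewrite conjcK.
- by move=> *; rewrite rmorphD.
- by move=> *; rewrite rmorphM mulrC.
Qed.

Fact s7_oner_neq0 : s7_one != s7_zero.
Proof. by apply/eqP => /clsP/ev_cong /= /eqP; rewrite oner_eq0. Qed.

HB.instance Definition _ := GRing.Zmodule_isNzRing.Build Sphere7
  s7_mulA s7_mul1x s7_mulx1 s7_mulDl s7_mulDr s7_oner_neq0.

Fact s7_scaleA c d x : s7_scale c (s7_scale d x) = s7_scale (c * d) x.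
Proof.
elim/clsW: x => s; rewrite !clsE; apply/clsP.
apply: cong_trans (cong_mulA _ _ _ _) _.
by apply: cong_mul; [exact: cong_cstM | exact: cong_refl].
Qed.

Fact s7_scaleDr : right_distributive s7_scale +%R.
Proof.
move=> c; elim/clsW=> s; elim/clsW=> t.
by rewrite /GRing.add /= !clsE; apply/clsP; exact: cong_mulDr.
Qed.

Fact s7_scaleDl' x : {morph s7_scale^~ x : c d / c + d}.
Proof. by move=> c d; exact: s7_scaleDl. Qed.

HB.instance Definition _ := GRing.Zmodule_isLmodule.Build R[i] Sphere7
  s7_scaleA s7_scale1 s7_scaleDr s7_scaleDl'.

Fact s7_scaleAl (c : R[i]) (x y : Sphere7) : c *: (x * y) = (c *: x) * y.
Proof.
elim/clsW: x => s; elim/clsW: y => t.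
by rewrite /GRing.scale /GRing.mul /= !clsE; apply/clsP; exact: cong_mulA.
Qed.
HB.instance Definition _ := GRing.Lmodule_isLalgebra.Build R[i] Sphere7 s7_scaleAl.

Fact s7_scaleAr (c : R[i]) (x y : Sphere7) : c *: (x * y) = x * (c *: y).
Proof.
elim/clsW: x => s; elim/clsW: y => t.
rewrite /GRing.scale /GRing.mul /= !clsE; apply/clsP.
apply: cong_trans (cong_mulA _ _ _ _) _.
apply: cong_trans (cong_sym (cong_mulA _ _ _ _)).
by apply: cong_mul; [exact: cong_cstC | exact: cong_refl].
Qed.
HB.instance Definition _ := GRing.Lalgebra_isAlgebra.Build R[i] Sphere7 s7_scaleAr.

Fact s7_starK : involutive s7_star.
Proof. by elim/clsW=> s; rewrite !clsE; apply/clsP; exact: cong_starK. Qed.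

Fact s7_starD x y : s7_star (x + y) = s7_star x + s7_star y.
Proof.
elim/clsW: x => s; elim/clsW: y => t.
by rewrite /GRing.add /= !clsE; apply/clsP; exact: cong_starD.
Qed.

Fact s7_starM x y : s7_star (x * y) = s7_star y * s7_star x.
Proof.
elim/clsW: x => s; elim/clsW: y => t.
by rewrite /GRing.mul /= !clsE; apply/clsP; exact: cong_starM.
Qed.

Fact s7_starZ (c : R[i]) (x : Sphere7) : s7_star (c *: x) = c^* *: s7_star x.
Proof.
elim/clsW: x => s.
rewrite /GRing.scale /= !clsE; apply/clsP.
apply: cong_trans (cong_starM _ _ _) _.
apply: cong_trans (cong_sym (cong_cstC _ _ _)).
by apply: cong_mul; [exact: cong_refl | exact: cong_starC].
Qed.

HB.instance Definition _ :=
  isStarAlgebra.Build R Sphere7 s7_starK s7_starD s7_starM s7_starZ.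

Definition sph (i : 'I_4) : Sphere7 := cls (Gen i).

End Sphere7.

Arguments sph {R}.
Arguments Sphere7 {R}.

Section Sphere4.
Variables (R : realType) (q : R).

Let z (k : nat) : Sphere7 q := sph q (inord k.-1).

Definition s4_a : Sphere7 q := z 1 * star (z 4) - z 2 * star (z 3).
Definition s4_b : Sphere7 q := z 1 * z 3 + (q^-1)%:C *: (z 2 * z 4).
Definition s4_R : Sphere7 q := z 1 * star (z 1) + z 2 * star (z 2).

Definition s4_set : set (Sphere7 q) :=
  star_subalg [set x | x = s4_a \/ x = s4_b \/ x = s4_R].

Definition s4_pred : pred (Sphere7 q) := fun x => `[< s4_set x >].

Let s4_closed : star_subalg_closed s4_set.
Proof. exact: star_subalg_subproof. Qed.

Fact s4_subalg : subalg_closed s4_pred.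
Proof.
case: s4_closed => h1 hD hM hZ _; split.
- exact/asboolP.
- by move=> c x y /asboolP hx /asboolP hy; apply/asboolP; apply: hD; first exact: hZ.
- by move=> x y /asboolP hx /asboolP hy; apply/asboolP; exact: hM.
Qed.

HB.instance Definition _ :=
  GRing.isSubalgClosed.Build R[i] (Sphere7 q) s4_pred (GRing.subalg_closed_semi s4_subalg).

Record Sphere4 := MkSphere4 { s4_val :> Sphere7 q ; s4_valP : s4_pred s4_val }.
HB.instance Definition _ := [isSub for s4_val].
HB.instance Definition _ := [Choice of Sphere4 by <:].
HB.instance Definition _ := [SubChoice_isSubAlgebra of Sphere4 by <:].

Fact s4_star_subproof (x : Sphere4) : s4_pred (star (s4_val x)).
Proof. by case: s4_closed => _ _ _ _ hS; apply/asboolP; apply: hS; exact/asboolP/s4_valP. Qed.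

Definition s4_star (x : Sphere4) : Sphere4 := MkSphere4 (s4_star_subproof x).


Fact s4_starK : involutive s4_star.
Proof. by move=> x; apply: val_inj; exact: starK. Qed.
Fact s4_starD x y : s4_star (x + y) = s4_star x + s4_star y.
Proof. by apply: val_inj; exact: starD. Qed.
Fact s4_starM x y : s4_star (x * y) = s4_star y * s4_star x.
Proof. by apply: val_inj; exact: starM. Qed.
Fact s4_starZ (c : R[i]) (x : Sphere4) : s4_star (c *: x) = c^* *: s4_star x.
Proof. by apply: val_inj; exact: starZ. Qed.

HB.instance Definition _ :=
  isStarAlgebra.Build R Sphere4 s4_starK s4_starD s4_starM s4_starZ.

Fact s4_a_subproof : s4_pred s4_a.
Proof. by apply/asboolP; apply: (sub_smallest (@subset_refl _ _)); left. Qed.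
Fact s4_b_subproof : s4_pred s4_b.
Proof. by apply/asboolP; apply: (sub_smallest (@subset_refl _ _)); right; left. Qed.
Fact s4_R_subproof : s4_pred s4_R.
Proof. by apply/asboolP; apply: (sub_smallest (@subset_refl _ _)); right; right. Qed.

Definition gen_a : Sphere4 := MkSphere4 s4_a_subproof.
Definition gen_b : Sphere4 := MkSphere4 s4_b_subproof.
Definition gen_R : Sphere4 := MkSphere4 s4_R_subproof.

End Sphere4.
Arguments gen_a {R}.
Arguments gen_b {R}.
Arguments gen_R {R}.

Section Ell2.
Variables (R : realType) (I : choiceType).

Definition ell2_pred : pred (I -> R[i]^o) :=
  fun f => `[< summable [set: I] (fun i => (Normc.normc (f i) ^+ 2)%:E) >].

Fact ell2_submod : submod_closed ell2_pred.
Proof.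
have normc_ge0 (z : R[i]) : 0 <= Normc.normc z by case: z => x y; exact: sqrtr_ge0.
have sqE (f : I -> R[i]) i :
    (`|(Normc.normc (f i) ^+ 2)%:E| = (Normc.normc (f i) ^+ 2)%:E)%E.
  by rewrite gee0_abs// lee_fin sqr_ge0.
split.
  apply/asboolP; rewrite /summable esum1 ?ltry// => i _.
  by rewrite (Normc.normc0 R : Normc.normc ((0 : I -> R[i]^o) i) = 0) expr0n /= normr0.
move=> c f g /asboolP Sf /asboolP Sg; apply/asboolP.
pose F i := ((2 * Normc.normc c ^+ 2)%:E * (Normc.normc (f i) ^+ 2)%:E)%E.
pose G i := (2%:E * (Normc.normc (g i) ^+ 2)%:E)%E.
have summZ (k : R) (h : I -> \bar R) : 0 <= k -> (forall i, 0 <= h i)%E ->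
    summable [set: I] h -> summable [set: I] (fun i => k%:E * h i)%E.
  move=> k0 h0; rewrite /summable => hs.
  apply: (@le_lt_trans _ _ (k%:E * \esum_(i in [set: I]) `|h i|)%E); last first.
    by rewrite lte_mul_pinfty.
  apply: ge_ereal_sup => _ [A [finA _] <-].
  under eq_fsbigr do rewrite abseM (gee0_abs (_ : 0 <= k%:E)%E) ?lee_fin//.
  rewrite -ge0_mule_fsumr; last by move=> i; exact: abse_ge0.
  by apply: lee_wpmul2l => //; apply: esum_ge; exists A.
have SF : summable [set: I] F.
  apply: summZ => //; first by rewrite mulr_ge0 ?sqr_ge0.
  by move=> i; rewrite lee_fin sqr_ge0.
have SG : summable [set: I] G.
  by apply: summZ => // i; rewrite lee_fin sqr_ge0.
apply: le_lt_trans (summableD SF SG).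
apply: le_esum => i _; rewrite sqE /F /G /=.
set u := Normc.normc c; set v := Normc.normc (f i); set w := Normc.normc (g i).
have le1 : Normc.normc (c * f i + g i) <= u * v + w.
  by apply: le_trans (le_normcD _ _) _; rewrite Normc.normcM.
rewrite -/u -/v -/w ger0_norm ?lee_fin; last first.
  by apply: addr_ge0; rewrite mulr_ge0 ?sqr_ge0// mulr_ge0 ?sqr_ge0.
apply: (@le_trans _ _ ((u * v + w) ^+ 2)).
  by rewrite ler_sqr ?nnegrE ?normc_ge0// addr_ge0 ?mulr_ge0 ?normc_ge0.
have := sqr_ge0 (u * v - w); nra.
Qed.

Record Ell2 := MkEll2 { ell2_fun :> I -> R[i]^o ; ell2P : ell2_pred ell2_fun }.
HB.instance Definition _ := [isSub for ell2_fun].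
HB.instance Definition _ := [Choice of Ell2 by <:].
HB.instance Definition _ :=
  GRing.isSubmodClosed.Build R[i] (I -> R[i]^o) ell2_pred
    (GRing.submod_closed_semi ell2_submod).
HB.instance Definition _ := [SubChoice_isSubLmodule of Ell2 by <:].

Fact ket_subproof (j : I) : ell2_pred (fun i => (i == j)%:R).
Proof.
apply/asboolP.
rewrite /summable (_ : esum _ _ = \esum_(i in [set j]) 1%:E)%E.
  by rewrite esum_set1 ?ltry.
rewrite [RHS]esum_mkcond; apply: eq_esum => i _.
rewrite in_set1; case: eqVneq => _ /=.
  by rewrite -[LHS]/(`|Normc.normc (1 : R[i]) ^+ 2|%:E) Normc.normc1 expr1n normr1.
by rewrite -[LHS]/(`|Normc.normc (0 : R[i]) ^+ 2|%:E) Normc.normc0 expr0n normr0.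
Qed.

Definition ket (j : I) : Ell2 := MkEll2 (ket_subproof j).

Definition ell2_norm (u : Ell2) : R :=
  Num.sqrt (fine (\esum_(i in [set: I]) (Normc.normc (u i) ^+ 2)%:E)).

(* The sum of an absolutely summable real family. *)
Definition rsum (f : I -> R) : R :=
  fine (\esum_(i in [set: I]) (Num.max (f i) 0)%:E) -
  fine (\esum_(i in [set: I]) (Num.max (- f i) 0)%:E).

(* Antilinear in the first argument, linear in the second one. *)
Definition ip (u v : Ell2) : R[i] :=
  rsum (fun i => complex.Re ((u i)^* * v i)) +i* rsum (fun i => complex.Im ((u i)^* * v i)).

Record bounded_op := BoundedOp {
  bop_fun :> {linear Ell2 -> Ell2} ;
  bop_bounded : exists M : R, forall u, ell2_norm (bop_fun u) <= M * ell2_norm u }.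

Definition is_adjoint (T S : bounded_op) : Prop :=
  forall u v, ip (S u) v = ip u (T v).

(* [0 <= z] in R[i] entails that z is real. *)
Definition positive_op (P : bounded_op) : Prop := forall u, 0 <= ip u (P u).

(* [P] is the absolute value of [T], i.e. the positive square root of T^* T. *)
Definition is_abs (T P : bounded_op) : Prop :=
  positive_op P /\
  exists S, is_adjoint T S /\ forall u, P (P u) = S (T u).

(* The trace of |T|, computed in the canonical orthonormal basis, is finite. *)
Definition trace_class (T : bounded_op) : Prop :=
  exists P, is_abs T P /\
    (\esum_(j in [set: I]) (complex.Re (ip (ket j) (P (ket j))))%:E < +oo)%E.

Record is_star_rep (A : starAlgType R) (pi : A -> bounded_op) : Prop := {
  star_rep1 : forall u, pi 1 u = u ;
  star_repD : forall x y u, pi (x + y) u = pi x u + pi y u ;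
  star_repM : forall x y u, pi (x * y) u = pi x (pi y u) ;
  star_repZ : forall c x u, pi (c *: x) u = c *: pi x u ;
  star_repS : forall x, is_adjoint (pi x) (pi (star x)) }.

End Ell2.
Arguments ket {R I}.

(* The Hilbert space tensor square of l^2(N), with basis |n1, n2> = ket (n1, n2). *)
Notation ell2NN_op R := (bounded_op R (nat * nat)%type).

(* Main.v *)
(** A bounded operator [T] with an adjoint is trace class as soon as
    [sum_j ||T e_j||] is finite: [||P e_j|| = ||T e_j||] for [P = |T|], hence
    [<e_j, P e_j> <= ||T e_j||].  The absolute value is [P = M (1 - Y)] with
    [M] a common bound for [T] and [T^*], where [Y] solves [Y = (X + Y^2) / 2]
    for the contraction [X = 1 - T^* T / M^2]; it is the limit of the iteration
    [Y_(n+1) = (X + Y_n^2) / 2] from [Y_0 = 0].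

    The elements [y] such that [||sigma(y) |n1,n2>|| <= C q^(n1+n2)] form a left
    ideal [J], and [sum q^(n1+n2)] converges.  The [x] such that [x - eps x] and
    [star x - eps (star x)] lie in [J] form a star-subalgebra containing [a], [b], [R],
    that is, everything. *)

Require Import Defs.
From HB Require Import structures.
From mathcomp Require Import all_boot all_order all_algebra.
From mathcomp Require Import complex.
From mathcomp Require Import ring lra zify.
From mathcomp Require Import all_classical all_reals all_analysis.

Set Implicit Arguments.
Unset Strict Implicit.
Unset Printing Implicit Defensive.
Import Order.TTheory GRing.Theory Num.Theory numFieldNormedType.Exports.
Local Open Scope classical_set_scope.
Local Open Scope ring_scope.
Local Open Scope complex_scope.

Local Notation normc := Normc.normc.
Local Notation Re := complex.Re.
Local Notation Im := complex.Im.

Lemma maxr0B (R : realDomainType) (x : R) : Num.max x 0 - Num.max (- x) 0 = x.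
Proof.
case: (leP 0 x) => x0; first by rewrite max_r ?oppr_le0// subr0.
by rewrite max_l ?oppr_ge0 ?ltW// sub0r opprK.
Qed.

(** * Sums of real families *)

Section Summation.
Variables (R : realType) (I : choiceType).
Implicit Types f g : I -> R.

Let summ f := summable [set: I] (EFin \o f).
Let E f := fine (\esum_(i in [set: I]) (f i)%:E).

(** An unordered sum is the supremum over finite subsets, and each of these is enumerated by a
    duplicate-free sequence. Estimates can thus be made on finite real sums. *)
Lemma esum_le_bound g (M : R) :
  (forall s : seq I, uniq s -> \sum_(i <- s) g i <= M) ->
  (\esum_(i in [set: I]) (g i)%:E <= M%:E)%E.
Proof.
move=> gM; apply: ge_ereal_sup => _ [A [finA _] <-].
by rewrite fsbig_finite//= sumEFin lee_fin gM// finmap.fset_uniq.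
Qed.

Lemma sum_le_esum g (s : seq I) : (forall i, 0 <= g i) -> uniq s ->
  ((\sum_(i <- s) g i)%:E <= \esum_(i in [set: I]) (g i)%:E)%E.
Proof.
move=> g0 us; apply: esum_ge; exists [set` s]; first by split.
by rewrite -fsbig_seq// -sumEFin.
Qed.

Lemma summable_le f g : (forall i, `|f i| <= g i) ->
  summable [set: I] (EFin \o g) -> summable [set: I] (EFin \o f).
Proof.
move=> fg; apply: le_lt_trans; apply: le_esum => i _ /=.
by rewrite lee_fin (le_trans (fg i))// ler_norm.
Qed.

Lemma summable_fin_esum g : (forall i, 0 <= g i) -> summ g ->
  (\esum_(i in [set: I]) (g i)%:E)%E = (E g)%:E.
Proof.
move=> g0 sg; rewrite fineK// ge0_fin_numE; last by apply: esum_ge0 => i _; rewrite lee_fin.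
by apply: le_lt_trans sg; apply: le_esum => i _ /=; rewrite lee_fin ler_norm.
Qed.

Let E_ge0 g : (forall i, 0 <= g i) -> 0 <= E g.
Proof. by move=> g0; apply/fine_ge0/esum_ge0 => i _; rewrite lee_fin. Qed.

Let ED f g : (forall i, 0 <= f i) -> (forall i, 0 <= g i) -> summ f -> summ g ->
  E (f \+ g) = E f + E g.
Proof.
move=> f0 g0 sf sg; apply: EFin_inj; rewrite EFinD -!summable_fin_esum//.
- rewrite -esumD//.
    by move=> i _; rewrite lee_fin.
  by move=> i _; rewrite lee_fin.
- by move=> i /=; rewrite addr_ge0.
- exact: summableD sf sg.
Qed.

Let summ_maxr f : summ f -> summ (fun i => Num.max (f i) 0).
Proof.
move=> sf; apply: (summable_le (g := fun i => `|f i|)) => [i|].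
  by rewrite ger0_norm ?le_max ?lexx ?orbT// ge_max ler_norm normr_ge0.
by move: sf; rewrite /summ /summable/=; under [in X in _ -> X]eq_esum do rewrite normr_id.
Qed.

Lemma summable_opp f : summ f -> summ (\- f).
Proof. by move=> sf; rewrite /summ/= (_ : EFin \o _ = (\- (EFin \o f))%E)// -summableN. Qed.

(** [rsum] is defined through the positive part [p] and the negative part [n], but any splitting
    into nonnegative summable families gives the same value: [p + h = g + n] pointwise, and sums of
    nonnegative families are additive. *)
Let rsum_diff f g h : (forall i, 0 <= g i) -> (forall i, 0 <= h i) ->
  summ g -> summ h -> f = g \- h -> rsum f = E g - E h.
Proof.
move=> g0 h0 sg sh ->.
have sgh : summ (g \- h) by exact: summableD sg (summable_opp sh).
pose p i := Num.max (g i - h i) 0; pose n i := Num.max (- (g i - h i)) 0.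
have p0 i : 0 <= p i by rewrite le_max lexx orbT.
have n0 i : 0 <= n i by rewrite le_max lexx orbT.
have sp : summ p by exact: (summ_maxr sgh).
have sn : summ n by exact: (summ_maxr (summable_opp sgh)).
rewrite /rsum -/(E p) -/(E n).
have : E (p \+ h) = E (g \+ n).
  congr E; apply/funext => i; rewrite /= /p /n.
  by have := maxr0B (g i - h i); lra.
rewrite !ED//; lra.
Qed.

Lemma rsum_ge0E g : (forall i, 0 <= g i) -> summ g -> rsum g = E g.
Proof.
move=> g0 sg; rewrite (@rsum_diff g g (fun=> 0))//.
- by rewrite /E [X in _ - fine X]esum1// subr0.
- by rewrite /summ /summable/= esum1 ?ltry// => i _; rewrite normr0.
- by apply/funext => i /=; rewrite subr0.
Qed.

Let pp f i := Num.max (f i) 0.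

Let pp_ge0 f i : 0 <= pp f i. Proof. by rewrite le_max lexx orbT. Qed.

Let pp_summ f : summ f -> summ (pp f). Proof. exact: summ_maxr. Qed.

Let ppK f i : pp f i - pp (\- f) i = f i. Proof. exact: maxr0B. Qed.

Lemma rsumD f g : summ f -> summ g -> rsum (f \+ g) = rsum f + rsum g.
Proof.
move=> sf sg; have [sNf sNg] := (summable_opp sf, summable_opp sg).
rewrite (@rsum_diff _ (pp f \+ pp g) (pp (\- f) \+ pp (\- g))).
- rewrite !ED//; [|exact: pp_summ..].
  by rewrite /rsum -!/(E _) -!/(pp _); ring.
- by move=> i; rewrite addr_ge0.
- by move=> i; rewrite addr_ge0.
- exact: summableD (pp_summ sf) (pp_summ sg).
- exact: summableD (pp_summ sNf) (pp_summ sNg).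
- by apply/funext => i /=; have := ppK f i; have := ppK g i; lra.
Qed.

Lemma rsumN f : rsum (\- f) = - rsum f.
Proof. by rewrite /rsum opprB; under [X in _ - fine X]eq_esum do rewrite opprK. Qed.

Lemma summableZ c f : summ f -> summ (c \*o f).
Proof.
move=> sf; apply: (@le_lt_trans _ _ (`|c| * E (fun i => `|f i|))%:E); last by rewrite ltry.
apply: esum_le_bound => s us.
under eq_bigr do rewrite /= normrM.
rewrite -mulr_sumr ler_wpM2l// -lee_fin -summable_fin_esum//.
  exact: sum_le_esum.
by move: sf; rewrite /summ /summable/=; under [in X in _ -> X]eq_esum do rewrite normr_id.
Qed.

(** The inequality [le] is enough: for [c > 0] the reverse one is [le] for the factor [c^-1] and the
    family [c g]. *)
Let EZ c g : 0 <= c -> (forall i, 0 <= g i) -> summ g -> E (c \*o g) = c * E g.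
Proof.
move=> c0 g0 sg.
have le k h : 0 <= k -> (forall i, 0 <= h i) -> summ h -> E (k \*o h) <= k * E h.
  move=> k0 h0 sh; rewrite -lee_fin -summable_fin_esum; first last.
  - exact: summableZ.
  - by move=> i; rewrite mulr_ge0.
  apply: esum_le_bound => s us; rewrite -mulr_sumr ler_wpM2l// -lee_fin.
  by rewrite -summable_fin_esum//; exact: sum_le_esum.
apply/eqP; rewrite eq_le le//=.
move: c0; rewrite le0r => /orP[/eqP->|c0].
  by rewrite mul0r E_ge0// => i /=; rewrite mul0r.
rewrite -ler_pdivlMl//; apply: le_trans (le c^-1 (c \*o g) _ _ _); last first.
- exact: summableZ.
- by move=> i; rewrite mulr_ge0// ltW.
- by rewrite invr_ge0 ltW.
rewrite le_eqVlt; apply/orP; left; apply/eqP; congr E; apply/funext => i /=.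
by rewrite mulKf// gt_eqF.
Qed.

Lemma rsumZ c f : summ f -> rsum (c \*o f) = c * rsum f.
Proof.
(* A negative factor exchanges positive and negative parts, so it is reduced to its opposite by
   [rsumN]. *)
wlog c0 : c / 0 <= c => [hw sf|sf].
  case: (leP 0 c) => [c0|c0]; first exact: hw.
  rewrite (_ : c \*o f = \- ((- c) \*o f)); last by apply/funext => i /=; ring.
  by rewrite rsumN hw ?oppr_ge0 ?ltW//; ring.
rewrite (@rsum_diff _ (c \*o pp f) (c \*o pp (\- f))).
- rewrite !EZ//; [by rewrite -mulrBr|exact/pp_summ/summable_opp|exact: pp_summ].
- by move=> i /=; rewrite mulr_ge0.
- by move=> i /=; rewrite mulr_ge0.
- exact/summableZ/pp_summ.
- exact/summableZ/pp_summ/summable_opp.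
- by apply/funext => i /=; rewrite -mulrBr ppK.
Qed.

End Summation.

(** * The geometry of l^2 *)

Section Normc.
Variable R : realType.
Implicit Types z w : R[i].

Lemma sqr_normc_ReIm z : normc z ^+ 2 = Re z ^+ 2 + Im z ^+ 2.
Proof. by case: z => x y; rewrite /= sqr_sqrtr// addr_ge0 ?sqr_ge0. Qed.

Lemma normc_ge0 z : 0 <= normc z.
Proof. by case: z => x y; exact: sqrtr_ge0. Qed.

Lemma norm_Re_le z : `|Re z| <= normc z.
Proof. by case: z => x y; rewrite /= -sqrtr_sqr ler_wsqrtr// lerDl sqr_ge0. Qed.

Lemma Re_mulJ z : Re (z^* * z) = normc z ^+ 2.
Proof. by rewrite sqr_normc_ReIm; case: z => x y /=; ring. Qed.

Lemma Im_mulJ z : Im (z^* * z) = 0.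
Proof. by case: z => x y /=; ring. Qed.

Lemma normc_real (x : R) : normc x%:C = `|x|.
Proof. by rewrite /= expr0n addr0 sqrtr_sqr. Qed.

Lemma ReD z w : Re (z + w) = Re z + Re w.
Proof. by case: z w => [x y] []. Qed.

(** A crude form of the arithmetic-geometric mean inequality. Together with its analogue for [Im] it
    dominates the terms of an inner product by a summable family. *)
Lemma norm_Re_mulJ_le z w : `|Re (z^* * w)| <= normc z ^+ 2 + normc w ^+ 2.
Proof.
rewrite !sqr_normc_ReIm; case: z w => [x y] [x' y'] /=.
have := sqr_ge0 (x - x'); have := sqr_ge0 (y - y').
have := sqr_ge0 (x + x'); have := sqr_ge0 (y + y').
by rewrite ler_norml => *; apply/andP; split; nra.
Qed.

Lemma norm_Im_mulJ_le z w : `|Im (z^* * w)| <= normc z ^+ 2 + normc w ^+ 2.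
Proof.
rewrite !sqr_normc_ReIm; case: z w => [x y] [x' y'] /=.
have := sqr_ge0 (x - y'); have := sqr_ge0 (y - x').
have := sqr_ge0 (x + y'); have := sqr_ge0 (y + x').
by rewrite ler_norml => *; apply/andP; split; nra.
Qed.

End Normc.

Section Ell2Geometry.
Variables (R : realType) (I : choiceType).
Local Notation H := (Ell2 R I).
Local Notation N := (@ell2_norm R I).
Implicit Types (u v w : H) (c : R[i]).

Lemma ell2E u v : (forall i, u i = v i) -> u = v.
Proof. by move=> uv; apply: val_inj; apply/funext. Qed.

Lemma ell2_addE u v i : (u + v) i = u i + v i. Proof. by []. Qed.
Lemma ell2_scaleE c u i : (c *: u) i = c * u i. Proof. by []. Qed.
Lemma ell2_oppE u i : (- u) i = - u i. Proof. by []. Qed.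

Lemma ell2_summable u :
  summable [set: I] (EFin \o (fun i => normc (u i) ^+ 2)).
Proof. by have /asboolP := ell2P u. Qed.

Let summable2 u v :
  summable [set: I] (EFin \o (fun i => normc (u i) ^+ 2 + normc (v i) ^+ 2)).
Proof. exact: summableD (ell2_summable u) (ell2_summable v). Qed.

Lemma summable_Re_ip u v :
  summable [set: I] (EFin \o (fun i => Re ((u i)^* * v i))).
Proof. by apply: summable_le (summable2 u v) => i; exact: norm_Re_mulJ_le. Qed.

Lemma summable_Im_ip u v :
  summable [set: I] (EFin \o (fun i => Im ((u i)^* * v i))).
Proof. by apply: summable_le (summable2 u v) => i; exact: norm_Im_mulJ_le. Qed.

Lemma ip_conj u v : ip v u = (ip u v)^*.
Proof.
rewrite /ip /=; congr (_ +i* _).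
  by congr rsum; apply/funext => i; case: (u i) (v i) => [x y] [x' y'] /=; ring.
rewrite -rsumN; congr rsum; apply/funext => i.
by rewrite /=; case: (u i) (v i) => [x y] [x' y'] /=; ring.
Qed.

Lemma ipDr u v w : ip u (v + w) = ip u v + ip u w.
Proof.
rewrite /ip; simpc; rewrite -!rsumD; [|exact: summable_Im_ip..|exact: summable_Re_ip|exact: summable_Re_ip].
by congr (_ +i* _); congr rsum; apply/funext => i; rewrite ell2_addE/=;
  case: (u i) (v i) (w i) => [x y] [x' y'] [x'' y''] /=; ring.
Qed.

Lemma ipZr c u v : ip u (c *: v) = c * ip u v.
Proof.
have Sr := summable_Re_ip u v; have Si := summable_Im_ip u v.
case: c => a b; rewrite /ip; simpc; rewrite -!rsumZ// -rsumN -!rsumD;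
  [|exact: summableZ..|exact: summableZ|exact/summable_opp/summableZ].
by congr (_ +i* _); congr rsum; apply/funext => i; rewrite ell2_scaleE/=;
  case: (u i) (v i) => [x y] [x' y'] /=; ring.
Qed.

Lemma ipNr u v : ip u (- v) = - ip u v.
Proof. by rewrite -scaleN1r ipZr mulN1r. Qed.

Lemma ip0r u : ip u 0 = 0.
Proof. by rewrite -(scale0r u) ipZr mul0r. Qed.

Lemma ip0l u : ip 0 u = 0.
Proof. by rewrite ip_conj ip0r conjc0. Qed.

Lemma ipBr u v w : ip u (v - w) = ip u v - ip u w.
Proof. by rewrite ipDr ipNr. Qed.

Lemma ipDl u v w : ip (u + v) w = ip u w + ip v w.
Proof. by rewrite ip_conj ipDr rmorphD [ip u w]ip_conj [ip v w]ip_conj. Qed.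

Lemma ipZl c u v : ip (c *: u) v = c^*%C * ip u v.
Proof. by rewrite ip_conj ipZr rmorphM [ip u v]ip_conj. Qed.

Lemma ipNl u v : ip (- u) v = - ip u v.
Proof. by rewrite ip_conj ipNr rmorphN [ip u v]ip_conj. Qed.

Lemma ipBl u v w : ip (u - v) w = ip u w - ip v w.
Proof. by rewrite ipDl ipNl. Qed.

Lemma ell2_norm_ge0 u : 0 <= N u.
Proof. exact: sqrtr_ge0. Qed.

Lemma sqr_ell2_norm u :
  ((N u ^+ 2)%:E = \esum_(i in [set: I]) (normc (u i) ^+ 2)%:E)%E.
Proof.
rewrite /ell2_norm sqr_sqrtr; last first.
  by apply/fine_ge0/esum_ge0 => i _; rewrite lee_fin sqr_ge0.
by rewrite -summable_fin_esum//; [move=> i; exact: sqr_ge0|exact: ell2_summable].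
Qed.

Lemma ip_self u : ip u u = (N u ^+ 2)%:C.
Proof.
rewrite /ip; congr (_ +i* _); last first.
  under [X in rsum X]eq_fun do rewrite Im_mulJ.
  by rewrite rsum_ge0E// ?esum1// /summable esum1 ?ltry//= => i; rewrite normr0.
under [X in rsum X]eq_fun do rewrite Re_mulJ.
rewrite rsum_ge0E; [by rewrite -sqr_ell2_norm| |exact: ell2_summable].
by move=> i; exact: sqr_ge0.
Qed.

Lemma normc_le_ell2_norm u i : normc (u i) <= N u.
Proof.
rewrite -(ler_sqr (normc_ge0 _) (ell2_norm_ge0 _)) -lee_fin sqr_ell2_norm.
have := @sum_le_esum _ _ (fun i => normc (u i) ^+ 2) [:: i] (fun i => sqr_ge0 _) isT.
by rewrite big_seq1.
Qed.

Lemma ell2_norm_eq0 u : N u <= 0 -> u = 0.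
Proof.
move=> u0; apply: ell2E => i; apply: Normc.eq0_normc.
by apply/le_anti; rewrite normc_ge0 andbT (le_trans (normc_le_ell2_norm u i)).
Qed.

Lemma ell2_norm0 : N 0 = 0.
Proof.
apply/eqP; rewrite -(@eqrXn2 _ 2)// ?ell2_norm_ge0//.
by have := ip_self 0; rewrite ip0r => -[<-]; rewrite expr0n.
Qed.

(** For a = ||u|| and b = ||v||, the squared norm of b u - a v equals 2ab (ab - Re <u,v>) and is
    nonnegative. Division by ab is what sets the zero vectors apart. *)
Lemma Re_ip_le u v : Re (ip u v) <= N u * N v.
Proof.
have [u0|u0] := leP (N u) 0.
  by rewrite (ell2_norm_eq0 u0) ip0l ell2_norm0 mul0r.
have [v0|v0] := leP (N v) 0.
  by rewrite (ell2_norm_eq0 v0) ip0r ell2_norm0 mulr0.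
have := ip_self ((N v)%:C *: u - (N u)%:C *: v).
rewrite !ipBr !ipBl !ipZl !ipZr !ip_self [ip v u]ip_conj.
move/(congr1 (@complex.Re R)).
have := sqr_ge0 (N ((N v)%:C *: u - (N u)%:C *: v)).
case: (ip u v) => x y; move: (N (_ - _)) => k; rewrite /=; simpc => /= k0 e.
have uv : 0 < N u * N v by rewrite mulr_gt0.
rewrite -(ler_pM2l uv); move: e k0; lra.
Qed.

Lemma ell2_normD u v : N (u + v) <= N u + N v.
Proof.
rewrite -ler_sqr ?nnegrE ?addr_ge0 ?ell2_norm_ge0//.
have := ip_self (u + v).
rewrite !ipDr !ipDl !ip_self [ip v u]ip_conj => /(congr1 (@complex.Re R)).
have := Re_ip_le u v.
case: (ip u v) => x y /=; nra.
Qed.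

Lemma ell2_normZ c u : N (c *: u) = normc c * N u.
Proof.
apply/eqP; rewrite -(@eqrXn2 _ 2)// ?mulr_ge0 ?ell2_norm_ge0 ?normc_ge0//; apply/eqP.
have := ip_self (c *: u).
rewrite ipZl ipZr mulrA ip_self => /(congr1 (@complex.Re R)) /= <-.
rewrite exprMn sqr_normc_ReIm; case: c => a b /=; ring.
Qed.

Lemma ell2_normN u : N (- u) = N u.
Proof. by rewrite -scaleN1r ell2_normZ normcN Normc.normc1 mul1r. Qed.

Lemma ell2_distC u v : N (u - v) = N (v - u).
Proof. by rewrite -ell2_normN opprB. Qed.

Lemma ell2_dist_triangle w u v : N (u - v) <= N (u - w) + N (w - v).
Proof. by apply: le_trans (ell2_normD _ _); rewrite addrA subrK. Qed.

Lemma ell2_norm_le u (M : R) : 0 <= M ->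
  (forall s : seq I, uniq s -> \sum_(i <- s) normc (u i) ^+ 2 <= M ^+ 2) -> N u <= M.
Proof.
move=> M0 uM; rewrite -ler_sqr ?nnegrE ?ell2_norm_ge0//.
by rewrite -lee_fin sqr_ell2_norm esum_le_bound.
Qed.

Lemma sum_le_ell2_norm u (s : seq I) : uniq s ->
  \sum_(i <- s) normc (u i) ^+ 2 <= N u ^+ 2.
Proof. by move=> us; rewrite -lee_fin sqr_ell2_norm sum_le_esum// => i; exact: sqr_ge0. Qed.

End Ell2Geometry.

(** * Completeness of l^2, and the rate of the square root iteration *)

Lemma rate_cvg (R : realType) (x d : nat -> R) : d @ \oo --> 0 ->
  (forall n m, (n <= m)%N -> `|x m - x n| <= d n) -> cvgn x.
Proof.
move=> d0 xd; apply: cauchy_cvg; apply: cauchy_exP => e e0.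
have [n _ dn] := cvgr0_norm_lt _ d0 _ e0.
exists (x n); change (\forall m \near \oo, ball (x n) e (x m)); near=> m.
rewrite /ball /= distrC.
have nm : (n <= m)%N by near: m; exact: nbhs_infty_ge.
apply: le_lt_trans (xd _ _ nm) _.
by apply: le_lt_trans (dn n _); rewrite //= ler_norm.
Unshelve. all: by end_near. Qed.

Section Completeness.
Variables (R : realType) (I : choiceType).
Local Notation H := (Ell2 R I).
Local Notation N := (@ell2_norm R I).

(** The limit is taken coordinate by coordinate. For each finite set of indices the bound [d n]
    survives the passage to the limit, and it does not depend on that set, so it bounds the full
    norm. *)
Lemma ell2_complete (w : nat -> H) (d : nat -> R) : d @ \oo --> 0 ->
  (forall n m, (n <= m)%N -> N (w m - w n) <= d n) ->
  exists v, forall n, N (w n - v) <= d n.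
Proof.
move=> d0 wd.
have wdi n m i : (n <= m)%N -> normc (w m i - w n i) <= d n.
  by move=> nm; apply: le_trans (wd _ _ nm); exact: (normc_le_ell2_norm (w m - w n)).
have d_ge0 n : 0 <= d n by apply: le_trans (wd n n _); rewrite ?ell2_norm_ge0.
have cRe i : cvgn (fun n => Re (w n i)).
  apply: rate_cvg d0 _ => n m nm; apply: le_trans (wdi _ _ i nm).
  by apply: le_trans (norm_Re_le _); case: (w m i) (w n i) => [x y] [].
have cIm i : cvgn (fun n => Im (w n i)).
  apply: rate_cvg d0 _ => n m nm; apply: le_trans (wdi _ _ i nm).
  rewrite -(ler_sqr (normr_ge0 _) (normc_ge0 _)) real_normK ?num_real// sqr_normc_ReIm.
  by case: (w m i) (w n i) => [x y] [x' y'] /=; rewrite lerDr sqr_ge0.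
pose v i := limn (fun n => Re (w n i)) +i* limn (fun n => Im (w n i)).
have hRe n i : Re (w n i - w m i) @[m --> \oo] --> Re (w n i - v i).
  rewrite (_ : Re _ = Re (w n i) - Re (v i)); last by case: (w n i).
  rewrite (_ : (fun m => Re _) = (fun m => Re (w n i) - Re (w m i))); last first.
    by apply/funext => m; case: (w n i) (w m i) => [x y] [].
  by apply: cvgB; [exact: cvg_cst|exact: cRe].
have hIm n i : Im (w n i - w m i) @[m --> \oo] --> Im (w n i - v i).
  rewrite (_ : Im _ = Im (w n i) - Im (v i)); last by case: (w n i).
  rewrite (_ : (fun m => Im _) = (fun m => Im (w n i) - Im (w m i))); last first.
    by apply/funext => m; case: (w n i) (w m i) => [x y] [].
  by apply: cvgB; [exact: cvg_cst|exact: cIm].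
have bound n (s : seq I) : uniq s -> \sum_(i <- s) normc (w n i - v i) ^+ 2 <= d n ^+ 2.
  move=> us.
  have : (\sum_(i <- s) normc (w n i - w m i) ^+ 2) @[m --> \oo] -->
         \sum_(i <- s) normc (w n i - v i) ^+ 2.
    apply: cvg_big => [|i _]; first exact: add_continuous.
    under eq_cvg do rewrite sqr_normc_ReIm.
    rewrite sqr_normc_ReIm; apply: cvgD; apply: cvgM.
    - exact: hRe.
    - exact: hRe.
    - exact: hIm.
    - exact: hIm.
  move=> h; apply: (cvgr_to_le h); near=> m.
  have nm : (n <= m)%N by near: m; exact: nbhs_infty_ge.
  apply: le_trans (_ : N (w n - w m) ^+ 2 <= _).
    exact: (sum_le_ell2_norm (w n - w m)).
  by rewrite ler_sqr ?nnegrE ?ell2_norm_ge0// ell2_distC wd.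
(* Square summability is read off for the difference [w 0 - v], to which [bound] applies; the limit
   is then recovered as [w 0 - (w 0 - v)]. *)
have ev : ell2_pred (fun i => w 0%N i - v i : R[i]^o).
  apply/asboolP; apply: le_lt_trans (ltry (d 0%N ^+ 2)).
  apply: esum_le_bound => s us; apply: le_trans (bound 0%N s us).
  by apply: ler_sum => i _; rewrite ger0_norm ?sqr_ge0.
exists (w 0%N - MkEll2 ev) => n; apply: ell2_norm_le => // s us.
apply: le_trans (bound n s us); apply: ler_sum => i _.
by rewrite ell2_addE ell2_oppE ell2_addE ell2_oppE /= subKr.
Unshelve. all: by end_near. Qed.

(* [1 - sqrt_rate n] is the [n]-th iterate of [y |-> (1 + y^2) / 2] from [0]; it
   bounds the norm of [sqrt_approx n]. *)
Fixpoint sqrt_rate (n : nat) : R :=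
  if n is n'.+1 then sqrt_rate n' - sqrt_rate n' ^+ 2 / 2 else 1.

(** The map d - d^2/2 increases on [0,1]. With t = n + 2 its value at 2/t is 2(t-1)/t^2, which is at
    most 2/(t+1) because (t-1)(t+1) <= t^2. *)
Lemma sqrt_rate_bounds n : 0 <= sqrt_rate n <= 2 / n.+2%:R.
Proof.
elim: n => [|n /=]; first by rewrite /= divff// ler01 lexx.
set d := sqrt_rate n => /andP[d0 dn].
have n2 : 2 <= n.+2%:R :> R by rewrite ler_nat.
have dm : d * n.+2%:R <= 2 by rewrite -ler_pdivlMr ?ltr0n.
have e3 : n.+3%:R = n.+2%:R + 1 :> R by rewrite -natr1.
have d1 : d <= 1 by nra.
apply/andP; split; first by nra.
rewrite ler_pdivlMr ?ltr0n// e3; move: (n.+2%:R) n2 dm => t {e3 dn} n2 dm.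
nra.
Qed.

Lemma sqrt_rate_cvg : sqrt_rate @ \oo --> 0.
Proof.
apply: (@squeeze_cvgr _ _ _ _ (fun=> 0) (fun n => 2 * harmonic n)).
- near=> n; have /andP[-> h] /= := sqrt_rate_bounds n.
  apply: le_trans h _; rewrite ler_pM2l// lef_pV2 ?posrE ?ltr0n// ler_nat//.
- exact: cvg_cst.
- rewrite -[X in _ --> X](mulr0 2); apply: cvgM; [exact: cvg_cst|exact: cvg_harmonic].
Unshelve. all: by end_near. Qed.

End Completeness.

(** * Square roots and absolute values *)

Section SquareRoot.
Variables (R : realType) (I : choiceType).
Local Notation H := (Ell2 R I).
Local Notation N := (@ell2_norm R I).
Variable X : {linear H -> H}.
Hypothesis X_contr : forall u, N (X u) <= N u.
Hypothesis X_sym : forall u v, ip (X u) v = ip u (X v).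
Local Notation d := (@sqrt_rate R).

Fixpoint sqrt_approx (n : nat) : {linear H -> H} :=
  if n is n'.+1 then
    [the {linear H -> H} of (2^-1)%:C \*: (X \+ (sqrt_approx n' \o sqrt_approx n'))]
  else [the {linear H -> H} of \0].

Lemma sqrt_approxS n u :
  sqrt_approx n.+1 u = (2^-1)%:C *: (X u + sqrt_approx n (sqrt_approx n u)).
Proof. by []. Qed.

Lemma normc_half : normc (2^-1 : R)%:C = 2^-1.
Proof. by rewrite normc_real ger0_norm// invr_ge0. Qed.

Lemma half_double (u : H) : (2^-1 : R)%:C *: u + (2^-1 : R)%:C *: u = u.
Proof. by rewrite -scalerDl -rmorphD -div1r -splitr scale1r. Qed.

Lemma sqrt_rate_le1 n : d n <= 1.
Proof.
elim: n => //= n; have /andP[d0 _] := sqrt_rate_bounds R n; nra.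
Qed.

Lemma sqrt_rate_leS n : d n.+1 <= d n.
Proof. by rewrite /= gerBl divr_ge0// sqr_ge0. Qed.

(** Norms are majorized by the same iteration with 1 in place of [X]: (1 + (1-d)^2)/2 = 1 - (d -
    d^2/2). *)
Lemma sqrt_approx_norm n u : N (sqrt_approx n u) <= (1 - d n) * N u.
Proof.
elim: n u => [|n IH] u; first by rewrite /= subrr mul0r ell2_norm0.
rewrite sqrt_approxS ell2_normZ normc_half.
have h1 := ell2_normD (X u) (sqrt_approx n (sqrt_approx n u)).
have h2 := IH (sqrt_approx n u); have h3 := IH u; have h4 := X_contr u.
have d1 := sqrt_rate_le1 n.
have h5 : (1 - d n) * N (sqrt_approx n u) <= (1 - d n) * ((1 - d n) * N u).
  by rewrite ler_wpM2l// subr_ge0.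
rewrite /= ler_pdivrMl//; apply: le_trans h1 _; lra.
Qed.

(** Increments are majorized by those of the scalar iteration as well: the factors 1 - d_(n+1) and 1
    - d_n add up to turn d_n - d_(n+1) into 2 (d_(n+1) - d_(n+2)). *)
Lemma sqrt_approx_step n u :
  N (sqrt_approx n.+1 u - sqrt_approx n u) <= (d n - d n.+1) * N u.
Proof.
elim: n u => [|n IH] u.
  rewrite sqrt_approxS /= subr0 addr0 ell2_normZ normc_half.
  by have := X_contr u; lra.
set Y := sqrt_approx n; set Z := sqrt_approx n.+1.
(* The splitting Z^2 - Y^2 = Z(Z - Y) + (Z - Y)Y holds without commutation of [Y] and [Z]. *)
have -> : sqrt_approx n.+2 u - Z u = (2^-1)%:C *: (Z (Z u - Y u) + (Z (Y u) - Y (Y u))).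
  rewrite sqrt_approxS {3}/Z sqrt_approxS -scalerBr -/Y -/Z; congr (_ *: _).
  by rewrite linearB addrA subrK opprD addrACA subrr add0r.
rewrite ell2_normZ normc_half ler_pdivrMl//.
have h1 := ell2_normD (Z (Z u - Y u)) (Z (Y u) - Y (Y u)).
have h2 := sqrt_approx_norm n.+1 (Z u - Y u).
have h3 := IH (Y u); have h4 := sqrt_approx_norm n u; have h5 := IH u.
have d1 := sqrt_rate_le1 n.+1.
have dd : 0 <= d n - d n.+1 by rewrite subr_ge0; exact: sqrt_rate_leS.
have h6 : (1 - d n.+1) * N (Z u - Y u) <= (1 - d n.+1) * ((d n - d n.+1) * N u).
  by rewrite ler_wpM2l// subr_ge0.
have h7 : (d n - d n.+1) * N (Y u) <= (d n - d n.+1) * ((1 - d n) * N u).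
  by rewrite ler_wpM2l.
apply: le_trans h1 _; apply: le_trans (lerD (le_trans h2 h6) (le_trans h3 h7)) _.
rewrite /=; lra.
Qed.

Lemma sqrt_approx_dist n m u : (n <= m)%N ->
  N (sqrt_approx m u - sqrt_approx n u) <= d n * N u.
Proof.
move=> nm.
(* The sharper bound [d n - d m] telescopes along the steps. *)
suff h : N (sqrt_approx m u - sqrt_approx n u) <= (d n - d m) * N u.
  apply: le_trans h _; rewrite ler_wpM2r ?ell2_norm_ge0// lerBlDr lerDl.
  by have /andP[] := sqrt_rate_bounds R m.
elim: m nm => [|m IH]; first by rewrite leqn0 => /eqP->; rewrite !subrr ell2_norm0 mul0r.
rewrite leq_eqVlt => /orP[/eqP->|nm]; first by rewrite !subrr ell2_norm0 mul0r.
apply: le_trans (ell2_dist_triangle (sqrt_approx m u) _ _) _.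
have -> : d n - d m.+1 = (d m - d m.+1) + (d n - d m) by rewrite [RHS]addrC subrKA.
by rewrite mulrDl; exact: lerD (sqrt_approx_step m u) (IH nm).
Qed.

Lemma sqrt_approx_sym n u v : ip (sqrt_approx n u) v = ip u (sqrt_approx n v).
Proof.
elim: n u v => [|n IH] u v; first by rewrite /= ip0l ip0r.
rewrite !sqrt_approxS ipZl ipZr ipDl ipDr X_sym !IH; congr (_ * _); exact: conjc_real.
Qed.

Lemma le0_of_sqrt_rate (x K : R) : (forall n, x <= K * d n) -> x <= 0.
Proof.
move=> xK; have h : (fun n => K * d n) @ \oo --> K * 0.
  by apply: cvgM; [exact: cvg_cst|exact: sqrt_rate_cvg].
rewrite -(mulr0 K); apply: (cvgr_to_ge h); near=> n; exact: xK.
Unshelve. all: by end_near. Qed.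

Lemma ell2_eq_of_dist (u v : H) (K : R) : (forall n, N (u - v) <= K * d n) -> u = v.
Proof.
by move=> /le0_of_sqrt_rate /ell2_norm_eq0 /eqP; rewrite subr_eq0 => /eqP.
Qed.

Lemma sqrt_lim_exists :
  exists Y : {linear H -> H}, forall n u, N (sqrt_approx n u - Y u) <= N u * d n.
Proof.
have /choice[Y Yu] (u : H) : exists v, forall n, N (sqrt_approx n u - v) <= N u * d n.
  apply: ell2_complete => [|n m nm].
    rewrite -[X in _ --> X](mulr0 (N u)); apply: cvgM; first exact: cvg_cst.
    exact: sqrt_rate_cvg.
  by rewrite mulrC; exact: sqrt_approx_dist.
(* The limit was chosen separately at each vector. Linearity follows from that of the approximants,
   with one error term for each of c u + v, u and v. *)
have linY : linear Y.
  move=> c u v; apply: (@ell2_eq_of_dist _ _ (N (c *: u + v) + normc c * N u + N v)) => n.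
  apply: le_trans (ell2_dist_triangle (sqrt_approx n (c *: u + v)) _ _) _.
  rewrite ell2_distC -addrA !mulrDl lerD//.
  rewrite linearP opprD addrACA -scalerBr.
  apply: le_trans (ell2_normD _ _) _; rewrite ell2_normZ lerD// -mulrA.
  by rewrite ler_wpM2l// normc_ge0.
pose L : {linear H -> H} := HB.pack Y (GRing.isLinear.Build _ _ _ _ Y linY).
by exists L => n u; exact: Yu.
Qed.

(* [1 - Y] is the square root of [1 - X]. *)
Lemma contraction_sqrt : exists Y : {linear H -> H},
  [/\ forall u, N (Y u) <= N u,
      forall u v, ip (Y u) v = ip u (Y v) &
      forall u, Y u + Y u = X u + Y (Y u)].
Proof.
have [Y YE] := sqrt_lim_exists.
have approx_contr n u : N (sqrt_approx n u) <= N u.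
  apply: le_trans (sqrt_approx_norm n u) _.
  rewrite ler_piMl ?ell2_norm_ge0// lerBlDr lerDl.
  by have /andP[] := sqrt_rate_bounds R n.
have Y_contr u : N (Y u) <= N u.
  rewrite -subr_le0; apply: (@le0_of_sqrt_rate _ (N u)) => n.
  have := ell2_dist_triangle (sqrt_approx n u) (Y u) 0.
  rewrite !subr0 ell2_distC.
  by have := YE n u; have := approx_contr n u; lra.
exists Y; split=> // [u v|u].
(* It is enough that the real part of the defect of symmetry is never positive: taking for the
   second vector the multiple of [v] by the conjugate of the defect makes this real part the squared
   modulus of the defect. *)
- have le0 u' v' : Re (ip (Y u') v' - ip u' (Y v')) <= 0.
    apply: (@le0_of_sqrt_rate _ (2 * (N u' * N v'))) => n.
    have -> : ip (Y u') v' - ip u' (Y v') =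
        ip (Y u' - sqrt_approx n u') v' + ip u' (sqrt_approx n v' - Y v').
      by rewrite ipBl ipBr sqrt_approx_sym; ring.
    have -> : 2 * (N u' * N v') * d n = N u' * d n * N v' + N u' * (N v' * d n) by ring.
    rewrite ReD lerD// (le_trans (Re_ip_le _ _))//.
      by rewrite ler_wpM2r ?ell2_norm_ge0// ell2_distC.
    by rewrite ler_wpM2l ?ell2_norm_ge0.
  apply/eqP; rewrite -subr_eq0; apply/eqP.
  have := le0 u ((ip (Y u) v - ip u (Y v))^* *: v).
  rewrite linearZ !ipZr -mulrBr Re_mulJ => h; apply: Normc.eq0_normc.
  by apply/eqP; rewrite -sqrf_eq0 eq_le h sqr_ge0.
(* The recursion 2 Y_(n+1) = X + Y_n^2 passes to the limit. Two errors come from its left side and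
   two from Y_n^2, each at most [N u * d n]; hence the factor 4. *)
- apply: (@ell2_eq_of_dist _ _ (4 * N u)) => n.
  set Z := sqrt_approx n.
  have Zs : X u + Z (Z u) = sqrt_approx n.+1 u + sqrt_approx n.+1 u.
    by rewrite sqrt_approxS half_double.
  have h1 := ell2_dist_triangle (X u + Z (Z u)) (Y u + Y u) (X u + Y (Y u)).
  have e1 : X u + Z (Z u) - (X u + Y (Y u)) = Z (Z u) - Y (Y u).
    by rewrite opprD addrACA subrr add0r.
  rewrite e1 Zs [in leRHS]opprD [in leRHS]addrACA in h1.
  have h2 := ell2_normD (Y u - sqrt_approx n.+1 u) (Y u - sqrt_approx n.+1 u).
  have h3 := ell2_dist_triangle (Z (Y u)) (Z (Z u)) (Y (Y u)).
  have h4 := YE n (Y u); have h5 := YE n.+1 u; have h6 := YE n u.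
  have h7 := approx_contr n (Z u - Y u).
  rewrite linearB/= in h7; rewrite [N (Y u - _)]ell2_distC in h2.
  have h9 : N (Y u) * d n <= N u * d n.
    by rewrite ler_wpM2r//; have /andP[] := sqrt_rate_bounds R n.
  have h10 := ler_wpM2l (ell2_norm_ge0 u) (sqrt_rate_leS n).
  have -> : 4 * N u * d n = N u * d n + N u * d n + (N u * d n + N u * d n) by ring.
  apply: le_trans h1 _; apply: lerD.
    by apply: le_trans h2 _; apply: lerD; exact: le_trans h5 h10.
  by apply: le_trans h3 _; apply: lerD; [exact: le_trans h7 h6|exact: le_trans h4 h9].
Qed.

End SquareRoot.

(** * Absolute values and a summability criterion for the trace class *)

Section TraceClass.
Variables (R : realType) (I : choiceType).
Local Notation H := (Ell2 R I).
Local Notation N := (@ell2_norm R I).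
Implicit Types T S : bounded_op R I.

Lemma bounded_op_pos_bound T : exists2 M : R, 0 < M & forall u, N (T u) <= M * N u.
Proof.
have [M MT] := bop_bounded T; exists (`|M| + 1); first by rewrite ltr_pwDr.
move=> u; apply: le_trans (MT u) _; rewrite ler_wpM2r ?ell2_norm_ge0//.
by rewrite (le_trans (ler_norm M))// lerDl.
Qed.

Lemma abs_exists T S : is_adjoint T S ->
  exists2 P, is_abs T P & forall u v, ip (P u) v = ip u (P v).
Proof.
move=> TS.
have [MT MT0 MTle] := bounded_op_pos_bound T.
have [MS MS0 MSle] := bounded_op_pos_bound S.
pose M := MT + MS; have M0 : 0 < M by rewrite addr_gt0.
have Tle u : N (T u) <= M * N u.
  by apply: le_trans (MTle u) _; rewrite ler_wpM2r ?ell2_norm_ge0// lerDl ltW.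
have Sle u : N (S u) <= M * N u.
  by apply: le_trans (MSle u) _; rewrite ler_wpM2r ?ell2_norm_ge0// lerDr ltW.
have ST u v : ip (T u) v = ip u (S v) by rewrite ip_conj -TS -ip_conj.
pose k := (M ^- 2)%:C.
pose X := [the {linear H -> H} of idfun \- (k \*: (S \o T))].
have kJ : k^*%C = k := conjc_real _.
have XE u : X u = u - k *: S (T u) by [].
have k2M : M ^- 2 * M ^+ 2 = 1 by rewrite mulVf// expf_neq0// gt_eqF.
have k0 : 0 <= M ^- 2 by rewrite invr_ge0 sqr_ge0.
(* With k = 1/M^2, ||Xu||^2 = ||u||^2 - 2k ||Tu||^2 + k^2 ||STu||^2. The bound of [S] by [M] makes
   the last term at most k ||Tu||^2. *)
have X_contr u : N (X u) <= N u.
  rewrite -ler_sqr ?nnegrE ?ell2_norm_ge0//.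
  have := ip_self (X u).
  rewrite XE ipBr !ipBl !ipZr !ipZl TS -ST !ip_self kJ.
  rewrite /k; simpc => /(congr1 (@complex.Re R)) /= <-.
  have hS : N (S (T u)) ^+ 2 <= M ^+ 2 * N (T u) ^+ 2.
    by rewrite -exprMn ler_sqr ?nnegrE ?mulr_ge0 ?ell2_norm_ge0// ltW.
  have h2 : M ^- 2 * (M ^- 2 * N (S (T u)) ^+ 2) <= M ^- 2 * N (T u) ^+ 2.
    by rewrite ler_wpM2l// ler_pdivrMl// exprn_gt0.
  have h3 : 0 <= M ^- 2 * N (T u) ^+ 2 by rewrite mulr_ge0// sqr_ge0.
  lra.
have X_sym u v : ip (X u) v = ip u (X v).
  by rewrite !XE ipBl ipBr ipZl ipZr TS ST kJ.
have [Y [Y_contr Y_sym YE]] := contraction_sqrt X_contr X_sym.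
(* From 2Y = X + Y^2 one gets (1 - Y)^2 = 1 - X = T^*T / M^2, whence the factor [M]. *)
pose P := [the {linear H -> H} of M%:C \*: (idfun \- Y)].
have PE u : P u = M%:C *: (u - Y u) by [].
have P_bounded : exists K : R, forall u, N (P u) <= K * N u.
  exists (M * 2) => u; rewrite PE ell2_normZ.
  have -> : normc M%:C = M by rewrite normc_real gtr0_norm.
  rewrite -mulrA ler_pM2l//.
  have := ell2_normD u (- Y u); rewrite ell2_normN; have := Y_contr u; lra.
exists (BoundedOp P_bounded); last first.
  move=> u v; change (ip (P u) v = ip u (P v)).
  by rewrite !PE ipZl ipZr ipBl ipBr Y_sym; congr (_ * _); exact: conjc_real.
split.
  move=> u; change (0 <= ip u (P u)); rewrite PE ipZr mulr_ge0//; first by rewrite ler0c ltW.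
  (* The symmetry of [Y] makes <u,Yu> real; by Cauchy-Schwarz and contractivity it is at most
     ||u||^2. *)
  rewrite lecE ipBr ip_self; apply/andP; split.
    have : Im (ip u (Y u)) = Im (ip u (Y u))^*.
      by rewrite -ip_conj -Y_sym.
    case: (ip u (Y u)) => a b /= h; rewrite eq_sym; apply/eqP; lra.
  have := Re_ip_le u (Y u); have := ell2_norm_ge0 u; have := Y_contr u.
  case: (ip u (Y u)) => a b /=; nra.
exists S; split=> // u; change (P (P u) = S (T u)).
rewrite !PE linearZ_LR -scalerBr scalerA.
have -> : u - Y u - Y (u - Y u) = k *: S (T u).
  rewrite (linearB Y).
  have -> : Y (Y u) = Y u + Y u - (u - k *: S (T u)) by rewrite YE XE addrC addKr.
  move: (k *: _) (Y u) => a b.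
  by apply: ell2E => i; rewrite !(ell2_addE, ell2_oppE); ring.
by rewrite scalerA /k -!rmorphM -expr2 mulrC k2M scale1r.
Qed.

(** ||Pu||^2 = <u,P^2 u> = <u,T^*T u> = ||Tu||^2. *)
Lemma abs_norm T P u : is_abs T P -> (forall u v, ip (P u) v = ip u (P v)) ->
  N (P u) = N (T u).
Proof.
move=> [_ [S [TS PP]]] P_sym.
apply/eqP; rewrite -(@eqrXn2 _ 2) ?ell2_norm_ge0//; apply/eqP.
apply: complexI; rewrite -!ip_self P_sym PP.
by rewrite ip_conj TS -ip_conj.
Qed.

Lemma ell2_norm_ket (j : I) : N (ket j) = 1.
Proof.
apply/eqP; rewrite -(@eqrXn2 _ 2) ?ell2_norm_ge0//; apply/eqP.
apply: EFin_inj; rewrite sqr_ell2_norm.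
rewrite (_ : esum _ _ = \esum_(i in [set j]) 1%:E)%E; first by rewrite esum_set1 ?expr1n.
rewrite [RHS]esum_mkcond; apply: eq_esum => i _; rewrite in_set1 /=.
by case: eqVneq => _; rewrite ?Normc.normc1 ?Normc.normc0 ?expr1n ?expr0n.
Qed.

Lemma trace_class_of_summable T S : is_adjoint T S ->
  (\esum_(j in [set: I]) (N (T (ket j)))%:E < +oo)%E -> trace_class T.
Proof.
move=> TS Tsum; have [P PT P_sym] := abs_exists TS; exists P; split=> //.
apply: le_lt_trans Tsum; apply: le_esum => j _; rewrite lee_fin.
apply: le_trans (Re_ip_le _ _) _.
by rewrite (abs_norm _ PT P_sym) ell2_norm_ket mul1r.
Qed.

End TraceClass.

(** * Operators with geometrically decaying columns *)

Section Kets.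
Variables (R : realType) (I : choiceType).
Local Notation H := (Ell2 R I).
Local Notation N := (@ell2_norm R I).
Implicit Types T S : bounded_op R I.

Lemma rsum_single (f : I -> R) j : (forall i, i != j -> f i = 0) -> rsum f = f j.
Proof.
move=> f0.
have single (g : I -> R) : (forall i, 0 <= g i) -> (forall i, i != j -> g i = 0) ->
    \esum_(i in [set: I]) (g i)%:E = (g j)%:E.
  move=> g0 gj; rewrite -[RHS](@esum_set1 _ _ j (EFin \o g)) ?lee_fin//.
  rewrite [RHS]esum_mkcond; apply: eq_esum => i _; rewrite in_set1 /=.
  by case: eqVneq => // ij; rewrite gj.
rewrite /rsum (single (fun i => Num.max (f i) 0)) ?(single (fun i => Num.max (- f i) 0)).
- exact: maxr0B.
- by move=> i; rewrite le_max lexx orbT.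
- by move=> i ij; rewrite f0// oppr0 maxxx.
- by move=> i; rewrite le_max lexx orbT.
- by move=> i ij; rewrite f0// maxxx.
Qed.

Lemma ip_ketl j (u : H) : ip (ket j) u = u j.
Proof.
rewrite /ip (rsum_single (j := j)) ?(rsum_single (j := j)) /= ?eqxx.
- by case: (u j) => x y /=; congr (_ +i* _); ring.
- by move=> i /negbTE ->; case: (u i) => x y /=; ring.
- by move=> i /negbTE ->; case: (u i) => x y /=; ring.
Qed.

Lemma ell2_norm_single (u : H) j : (forall i, i != j -> u i = 0) -> N u = normc (u j).
Proof.
move=> u0; rewrite -[RHS]mulr1 -(ell2_norm_ket R j) -ell2_normZ; congr N.
apply: ell2E => i; rewrite ell2_scaleE /=.
by case: eqVneq => [->|/u0 ->]; rewrite ?mulr1 ?mulr0.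
Qed.

(** The matrix of [S] is the conjugate transpose of that of [T], and the weights are real. The map
    [s] may identify indices, so a column of [S] can a priori have several nonzero entries. *)
Lemma adjoint_shiftE T S (w : I -> R) (s : I -> I) : is_adjoint T S ->
  (forall m, T (ket m) = (w m)%:C *: ket (s m)) ->
  forall n m, S (ket n) m = (w m)%:C * (n == s m)%:R.
Proof.
move=> TS Tw n m.
rewrite -ip_ketl ip_conj TS Tw ipZr ip_ketl rmorphM /=; congr (_ * _).
  exact: conjc_real.
by case: (n == s m); rewrite ?conjc1 ?conjc0.
Qed.

End Kets.

(** * Geometric sums over pairs of integers *)

Section Geometric.
Variables (R : realType) (q : R).
Hypotheses (q_gt0 : 0 < q) (q_lt1 : q < 1).

Lemma geometric_sum_le k : \sum_(i < k) q ^+ i <= (1 - q)^-1.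
Proof.
rewrite -[leRHS]mul1r ler_pdivlMr ?subr_gt0// mulrC -opprB mulNr -subrX1 opprB.
by rewrite gerBl exprn_ge0// ltW.
Qed.

(** A finite set of pairs lies in a square of side [k], where the sum factors into two geometric
    sums, each at most 1/(1-q). *)
Lemma geometric2_esum_lty (C : R) :
  (\esum_(n in [set: nat * nat]) (C * q ^+ (n.1 + n.2))%:E < +oo)%E.
Proof.
wlog C0 : C / 0 <= C => [hw|].
  apply: le_lt_trans (hw `|C| (normr_ge0 C)); apply: le_esum => n _.
  by rewrite lee_fin ler_wpM2r ?ler_norm// exprn_ge0// ltW.
apply: (@le_lt_trans _ _ (C * ((1 - q)^-1 * (1 - q)^-1))%:E); last exact: ltry.
apply: esum_le_bound => s us; rewrite -mulr_sumr ler_wpM2l//.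
pose k := (\max_(n <- s) maxn n.1 n.2).+1.
pose t := [seq (i, j) | i <- iota 0 k, j <- iota 0 k].
have st n : n \in s -> n \in t.
  move=> ns; have := @leq_bigmax_seq _ s predT (fun n => maxn n.1 n.2) n ns isT.
  rewrite geq_max => /andP[n1 n2]; apply/allpairsP; exists n.
  by rewrite !mem_iota /= !add0n !ltnS; split=> //; case: n {ns n1 n2}.
have ut : uniq t by apply: allpairs_uniq; rewrite ?iota_uniq// => -[a b] [c e].
apply: (@le_trans _ _ (\sum_(n <- t) q ^+ (n.1 + n.2))).
  rewrite [leRHS](bigID (mem s))/= -[X in _ <= X + _]big_filter.
  rewrite [X in _ <= X + _](perm_big s); last first.
    apply: uniq_perm; rewrite ?filter_uniq// => n; rewrite mem_filter /=.
    by case ns: (n \in s) => //=; rewrite st.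
  by rewrite lerDl sumr_ge0// => n _; rewrite exprn_ge0// ltW.
rewrite big_allpairs /=.
under eq_bigr do (under eq_bigr do rewrite exprD; rewrite -mulr_sumr).
rewrite -mulr_suml; have := geometric_sum_le k.
rewrite -(big_mkord xpredT (fun i => q ^+ i)) /index_iota subn0 => h.
by rewrite ler_pM// sumr_ge0// => i _; rewrite exprn_ge0// ltW.
Qed.

End Geometric.

(** * Induction over the generators of the quantum 4-sphere *)

Lemma star1 (R : realType) (A : starAlgType R) : star 1 = 1 :> A.
Proof. by rewrite -[LHS]mulr1 -{2}(starK 1) -starM mulr1 starK. Qed.

(** The image in the 7-sphere of the elements satisfying [Q] is a star-subalgebra containing the
    three generators, so by minimality it contains the whole 4-sphere; [s4_val] is injective. *)
Lemma sphere4_ind (R : realType) (q : R) (Q : Sphere4 q -> Prop) :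
  Q 1 -> (forall x y, Q x -> Q y -> Q (x + y)) ->
  (forall x y, Q x -> Q y -> Q (x * y)) -> (forall c x, Q x -> Q (c *: x)) ->
  (forall x, Q x -> Q (star x)) ->
  Q (gen_a q) -> Q (gen_b q) -> Q (gen_R q) -> forall x, Q x.
Proof.
move=> Q1 QD QM QZ QS Qa Qb QR x.
have /asboolP/(_ [set z | exists2 y : Sphere4 q, s4_val y = z & Q y]) := s4_valP x.
case; last by move=> y /val_inj ->.
split; last first.
  by move=> z [->|[->|->]]; [exists (gen_a q)|exists (gen_b q)|exists (gen_R q)].
split.
- by exists 1.
- by move=> _ _ [x1 <- Q1'] [x2 <- Q2]; exists (x1 + x2) => //; exact: QD.
- by move=> _ _ [x1 <- Q1'] [x2 <- Q2]; exists (x1 * x2) => //; exact: QM.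
- by move=> c _ [x1 <- Q1']; exists (c *: x1) => //; exact: QZ.
- by move=> _ [x1 <- Q1']; exists (star x1) => //; exact: QS.
Qed.

(** * The left ideal of decaying elements *)

Section Decay.
Variables (R : realType) (q : R) (A : starAlgType R) (pi : A -> ell2NN_op R).
Hypotheses (q_gt0 : 0 < q) (q_lt1 : q < 1) (pi_rep : is_star_rep pi).
Local Notation N := (@ell2_norm R (nat * nat)%type).

Definition decay (x : A) :=
  exists C : R, forall n1 n2, N (pi x (ket (n1, n2))) <= C * q ^+ (n1 + n2).

Lemma decay0 : decay 0.
Proof.
exists 0 => n1 n2; rewrite -(scale0r (0 : A)) (star_repZ pi_rep) scale0r.
by rewrite ell2_norm0 mul0r.
Qed.

Lemma decayD x y : decay x -> decay y -> decay (x + y).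
Proof.
move=> [C Cx] [D Dy]; exists (C + D) => n1 n2; rewrite (star_repD pi_rep) mulrDl.
exact: le_trans (ell2_normD _ _) (lerD (Cx n1 n2) (Dy n1 n2)).
Qed.

Lemma decayZ c x : decay x -> decay (c *: x).
Proof.
move=> [C Cx]; exists (normc c * C) => n1 n2; rewrite (star_repZ pi_rep) ell2_normZ -mulrA.
by rewrite ler_wpM2l ?normc_ge0.
Qed.

Lemma decayMl x y : decay y -> decay (x * y).
Proof.
move=> [C Cy]; have [M M0 Mx] := bounded_op_pos_bound (pi x).
exists (M * C) => n1 n2; rewrite (star_repM pi_rep) -mulrA.
by apply: le_trans (Mx _) _; rewrite ler_pM2l.
Qed.

Lemma decay_trace_class x : decay x -> trace_class (pi x).
Proof.
move=> [C Cx]; apply: (trace_class_of_summable (star_repS pi_rep x)).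
apply: le_lt_trans (geometric2_esum_lty q_gt0 q_lt1 C).
by apply: le_esum => -[n1 n2] _; rewrite lee_fin.
Qed.

End Decay.

(** * Congruence to the character modulo decaying elements *)

Section Character.
Variables (R : realType) (q : R) (A : starAlgType R) (pi : A -> ell2NN_op R).
Hypotheses (pi_rep : is_star_rep pi).
Variables (eps : {lrmorphism A -> R[i]^o}).
Local Notation decay := (decay q pi).

Definition decay_mod (x : A) := decay (x - eps x *: 1).

Lemma decay_mod1 : decay_mod 1.
Proof. by rewrite /decay_mod rmorph1 scale1r subrr; exact: decay0. Qed.

Lemma decay_modD x y : decay_mod x -> decay_mod y -> decay_mod (x + y).
Proof.
move=> dx dy; rewrite /decay_mod raddfD scalerDl opprD addrACA; exact: decayD.
Qed.

Lemma decay_modZ c x : decay_mod x -> decay_mod (c *: x).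
Proof.
have epsZ : eps (c *: x) = c * eps x by rewrite linearZ.
move=> dx; rewrite /decay_mod epsZ -scalerA -scalerBr; exact: decayZ.
Qed.

(* [xy - eps(xy) = x (y - eps y) + eps y (x - eps x)] only multiplies on the left. *)
Lemma decay_modM x y : decay_mod x -> decay_mod y -> decay_mod (x * y).
Proof.
move=> dx dy; rewrite /decay_mod.
have -> : x * y - eps (x * y) *: 1 =
    x * (y - eps y *: 1) + eps y *: (x - eps x *: 1).
  rewrite rmorphM mulrBr -scalerAr mulr1 scalerBr addrA subrK scalerA.
  by congr (_ - _ *: _); rewrite mulrC.
by apply: decayD => //; [exact: decayMl|exact: decayZ].
Qed.

Lemma decay_mod_ker x : eps x = 0 -> decay_mod x <-> decay x.
Proof. by rewrite /decay_mod => ->; rewrite scale0r subr0. Qed.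

End Character.

(** * Bounds on the weights of the representation *)

Section Weights.
Variables (R : realType) (q : R).
Hypotheses (q_gt0 : 0 < q) (q_lt1 : q < 1).

Lemma exprn_le_add n m : q ^+ (n + m) <= q ^+ n.
Proof.
have q0 := ltW q_gt0.
by rewrite exprD ler_piMr ?exprn_ge0// exprn_ile1// ltW.
Qed.

Lemma norm_weight_le k (c : R) : 0 <= c -> `|c * Num.sqrt (1 - q ^+ k)| <= c.
Proof.
move=> c0; rewrite ger0_norm ?mulr_ge0 ?sqrtr_ge0// ler_piMr//.
by rewrite -[leRHS](sqrtr1 R) ler_wsqrtr// gerBl exprn_ge0// ltW.
Qed.

(** At [n1 = 0] the lowered index is truncated to 0 instead of leaving the basis; the vanishing
    weight makes this harmless. *)
Lemma weight_a0 n2 :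
  q ^ ((0 + 2 * n2)%:Z - 1) * Num.sqrt (1 - q ^+ (2 * 0)) = 0.
Proof. by rewrite muln0 expr0 subrr sqrtr0 mulr0. Qed.

(** The exponent is n1 + 2 n2 for lowered index n1; both the extra power q^n2 and the square root
    are at most 1. *)
Lemma weight_aS n1 n2 : `|q ^ ((n1.+1 + 2 * n2)%:Z - 1) *
  Num.sqrt (1 - q ^+ (2 * n1.+1))| <= q ^+ (n1 + n2).
Proof.
have -> : (n1.+1 + 2 * n2)%:Z - 1 = (n1 + n2 + n2)%N%:Z by lia.
apply: le_trans (norm_weight_le _ (exprn_ge0 _ (ltW q_gt0))) _.
exact: exprn_le_add.
Qed.

Lemma expr_shift n : q^-1 * q ^+ n.+1 = q ^+ n.
Proof. by rewrite exprS mulKf// gt_eqF. Qed.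

End Weights.

(** * The trace class property on the kernel of the character *)

Theorem proposition8 (R : realType) (q : R) (q_gt0 : 0 < q) (q_lt1 : q < 1)
  (eps : {lrmorphism Sphere4 q -> R[i]^o})
  (eps_star : forall x, eps (star x) = (eps x)^*)
  (eps_R : eps (gen_R q) = 0)
  (eps_a : eps (gen_a q) = 0)
  (eps_b : eps (gen_b q) = 0)
  (sigma : Sphere4 q -> ell2NN_op R)
  (sigma_rep : is_star_rep sigma)
  (sigma_R : forall n1 n2 : nat,
     sigma (gen_R q) (ket (n1, n2)) =
       (q ^+ (2 * (n1 + n2)))%:C *: ket (n1, n2))
  (sigma_a : forall n1 n2 : nat,
     sigma (gen_a q) (ket (n1, n2)) =
       (q ^ ((n1 + 2 * n2)%:Z - 1) * Num.sqrt (1 - q ^+ (2 * n1)))%:C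
         *: ket (n1.-1, n2))
  (sigma_b : forall n1 n2 : nat,
     sigma (gen_b q) (ket (n1, n2)) =
       (q ^+ (n1 + n2) * Num.sqrt (1 - q ^+ (2 * n2.+1)))%:C
         *: ket (n1, n2.+1)) :
  (forall x : Sphere4 q, eps x = 0 -> trace_class (sigma x)) /\
  (forall x : Sphere4 q, exists! y : Sphere4 q,
     eps y = 0 /\ exists c : R[i], x = y + c%:A).
Proof.
have q0 := ltW q_gt0.
have ec x : eps x = 0 -> eps (star x) = 0 by rewrite eps_star => ->; exact: conjc0.
have dR : decay q sigma (gen_R q).
  exists 1 => n1 n2; rewrite sigma_R ell2_normZ ell2_norm_ket mulr1 mul1r normc_real.
  by rewrite ger0_norm ?exprn_ge0// mul2n -addnn exprn_le_add.
have da : decay q sigma (gen_a q).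
  (* The weight at n1 + 1 is only bounded by q^(n1+n2), one power short of the required decay; the
     constant [q^-1] restores it. *)
  exists q^-1 => n1 n2; rewrite sigma_a ell2_normZ ell2_norm_ket mulr1 normc_real.
  case: n1 => [|n1]; last by rewrite addSn expr_shift// weight_aS.
  by rewrite weight_a0 normr0 mulr_ge0 ?invr_ge0 ?exprn_ge0.
have db : decay q sigma (gen_b q).
  exists 1 => n1 n2; rewrite sigma_b ell2_normZ ell2_norm_ket mulr1 mul1r normc_real.
  by rewrite norm_weight_le// exprn_ge0.
have dsa : decay q sigma (star (gen_a q)).
  pose w (m : nat * nat) :=
    q ^ ((m.1 + 2 * m.2)%:Z - 1) * Num.sqrt (1 - q ^+ (2 * m.1)).
  have aE := adjoint_shiftE (w := w) (s := fun m => (m.1.-1, m.2))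
    (star_repS sigma_rep (gen_a q)) (fun m => ltac:(by case: m => m1 m2; exact: sigma_a)).
  exists 1 => n1 n2; rewrite mul1r (@ell2_norm_single _ _ _ (n1.+1, n2)); last first.
    (* Truncation sends both (0,n2) and (1,n2) to (0,n2); the entry of the adjoint at m1 = 0
       vanishes by its weight, so each column has a single possible nonzero entry. *)
    move=> [[|m1] m2] mn; rewrite aE; first by rewrite /w /= weight_a0 rmorph0 mul0r.
    have /negbTE -> : (n1, n2) != (m1, m2).
      by apply: contra mn => /eqP[-> ->].
    by rewrite mulr0.
  by rewrite aE /= eqxx mulr1 normc_real weight_aS.
have dsb : decay q sigma (star (gen_b q)).
  pose w (m : nat * nat) := q ^+ (m.1 + m.2) * Num.sqrt (1 - q ^+ (2 * m.2.+1)).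
  have bE := adjoint_shiftE (w := w) (s := fun m => (m.1, m.2.+1))
    (star_repS sigma_rep (gen_b q)) (fun m => ltac:(by case: m => m1 m2; exact: sigma_b)).
  exists q^-1 => n1 [|n2].
    (* The adjoint of [b] lowers n2 and kills the columns with n2 = 0; the index (0,0) is an
       arbitrary choice for a zero vector. *)
    rewrite (@ell2_norm_single _ _ _ (0, 0)%N) => [|[m1 m2] _].
      by rewrite bE xpair_eqE andbF mulr0 Normc.normc0 mulr_ge0 ?invr_ge0 ?exprn_ge0.
    by rewrite bE xpair_eqE andbF mulr0.
  rewrite (@ell2_norm_single _ _ _ (n1, n2)) => [|[m1 m2] mn].
    rewrite bE /= eqxx mulr1 normc_real addnS expr_shift//.
    by rewrite norm_weight_le// exprn_ge0.
  rewrite bE; have /negbTE -> : (n1, n2.+1) != (m1, m2.+1).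
    by apply: contra mn => /eqP[-> ->].
  by rewrite mulr0.
have sR : star (gen_R q) = gen_R q.
  by apply: val_inj; rewrite /= /s4_R starD !starM !starK.
(* Both [x] and [star x] are carried along, so that the star case of the induction is an exchange of
   the two halves. *)
have good x : decay_mod q sigma eps x /\ decay_mod q sigma eps (star x).
  elim/sphere4_ind: x => [|x y [dx dsx] [dy dsy]|x y [dx dsx] [dy dsy]|c x [dx dsx]|x [dx dsx]|||].
  - by rewrite star1; split; exact: decay_mod1.
  - by rewrite starD; split; exact: decay_modD.
  - by rewrite starM; split; exact: decay_modM.
  - by rewrite starZ; split; exact: decay_modZ.
  - by rewrite starK.
  - by split; apply/decay_mod_ker => //; exact: ec.
  - by split; apply/decay_mod_ker => //; exact: ec.
  - by rewrite sR; split; apply/decay_mod_ker.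
split=> [x x0|x].
  have [dx _] := good x; have {}dx := (decay_mod_ker q sigma x0).1 dx.
  exact: (decay_trace_class q_gt0 q_lt1 sigma_rep dx).
(* The second claim expresses the isomorphism of the kernel with the quotient by the scalars:
   applying [eps] to x = y + c forces c = [eps x]. *)
have epsA c : eps c%:A = c by rewrite linearZ_LR rmorph1; exact: mulr1.
exists (x - (eps x)%:A); split.
  split; last by exists (eps x); rewrite subrK.
  by rewrite rmorphB [X in _ - X]epsA subrr.
move=> y [y0 [c xE]].
have -> : eps x = c by rewrite xE rmorphD [X in _ + X]epsA [X in X + _]y0 add0r.
by rewrite xE addrK.
Qed.
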